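(* Let $G$ be a locally compact $E$-group with identity $e$ and let $T_1$ and $T_2$ be subsets of $G$ such that $T_1\cup T_2$ is right uniformly discrete with respect to some neighbourhood $U$ of $e$. If $UT_1$ and $UT_2$ are translation-compact, then $VT_1\cup VT_2$ is translation-compact for some neighbourhood $V$ of $e$.
   Context: $T\subseteq G$ is right uniformly discrete with respect to $U$ if $Us\cap Us'=\emptyset$ for all $s\ne s'$ in $T$. A set $S\subseteq G$ is right translation-compact if every non-relatively compact $L\subseteq G$ contains a finite subset $F$ such that $\bigcap_{b\in F}b^{-1}S$ is relatively compact; left translation-compact if the same holds with $\bigcap_{b\in F}Sb^{-1}$; translation-compact if both. For $G$ non-compact, an $E$-set is a non-relatively compact $T\subseteq G$ such that for each neighbourhood $N$ of $e$, $\bigcap\{t^{-1}Nt:t\in T\cup T^{-1}\}$ is a neighbourhood of $e$. $G$ is an $E$-group if it is non-compact and contains an $E$-set. *)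

(* Defs.v *)
From HB Require Import structures.
From mathcomp Require Import all_boot.
From mathcomp Require Import boolp classical_sets functions cardinality filter.
From mathcomp Require Import topology.

Set Implicit Arguments.
Unset Strict Implicit.
Unset Printing Implicit Defensive.

Local Open Scope classical_set_scope.
Local Open Scope group_scope.

HB.mixin Record PreTopologicalGroup_isTopologicalGroup G
    & Topological G & Group G := {
  mulg_continuous : continuous (fun x : G * G => x.1 * x.2) ;
  invg_continuous : continuous (fun x : G => x^-1) ;
}.

(* As for the library's topological structures, no separation axiom is part of
   the structure. *)
#[short(type="topologicalGroupType")]
HB.structure Definition TopologicalGroup :=
  {G of Topological G & Group G & PreTopologicalGroup_isTopologicalGroup G}.

Section SubsetsOfGroups.
Variable G : groupType.
Implicit Types (b : G) (A B : set G).

Definition mulset A B : set G := [set a * b | a in A & b in B].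

Definition ltrans b A : set G := [set b * a | a in A].

Definition rtrans A b : set G := [set a * b | a in A].

Definition invset A : set G := [set a^-1 | a in A].

Definition right_uniformly_discrete U (T : set G) : Prop :=
  forall s s', T s -> T s' -> s <> s' -> rtrans U s `&` rtrans U s' = set0.

End SubsetsOfGroups.

(* "Relatively compact" is the library's [precompact]: compact closure, see
   [precompactE]. *)
Section TranslationCompact.
Variable G : topologicalGroupType.
Implicit Types S T L F N : set G.

Definition right_translation_compact S : Prop :=
  forall L, ~ precompact L ->
    exists F, [/\ finite_set F, F `<=` L &
                  precompact (\bigcap_(b in F) ltrans b^-1 S)].

Definition left_translation_compact S : Prop :=
  forall L, ~ precompact L ->
    exists F, [/\ finite_set F, F `<=` L &
                  precompact (\bigcap_(b in F) rtrans S b^-1)].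

Definition translation_compact S : Prop :=
  right_translation_compact S /\ left_translation_compact S.

(* [x ^ t] is the conjugate [t^-1 * (x * t)]. *)
Definition E_set T : Prop :=
  ~ precompact T /\
  forall N, nbhs (1 : G) N ->
    nbhs (1 : G) (\bigcap_(t in T `|` invset T) [set x ^ t | x in N]).

End TranslationCompact.

Definition E_group (G : topologicalGroupType) : Prop :=
  ~ compact [set: G] /\ exists T : set G, E_set T.

(* Main.v *)
Require Import Defs.
From mathcomp Require Import all_boot.
From mathcomp Require Import boolp classical_sets functions cardinality filter.
From mathcomp Require Import topology.

Local Open Scope classical_set_scope.
Local Open Scope group_scope.

(* Translation-compact sets are closed under union. Suppose that no finite F in
   the non-relatively compact set L makes the intersection of the b^-1 (A u B),
   b in F, relatively compact. These intersections, with relatively compact sets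
   removed, generate a proper filter; let W be an ultrafilter containing it.
   Every b in L has b^-1 A in W or b^-1 B in W, so one of the two sets
   {b in L | b^-1 A in W} and {b in L | b^-1 B in W} is not relatively compact.
   A finite subset of it witnessing translation-compactness of A, resp. B, puts a
   relatively compact set in W, a contradiction. *)

Lemma precompact0 {X : topologicalType} : precompact (@set0 X).
Proof. by rewrite precompactE closure0; exact: compact0. Qed.

Lemma precompactU {X : topologicalType} (A B : set X) :
  precompact A -> precompact B -> precompact (A `|` B).
Proof. by rewrite !precompactE closureU; exact: compactU. Qed.

Lemma filter_bigcap_finite {I : choiceType} {T : Type} (D : set I)
    (f : I -> set T) (F : set_system T) :
  Filter F -> finite_set D -> (forall i, D i -> F (f i)) ->
  F (\bigcap_(i in D) f i).
Proof. by move=> FF /finite_fsetP[X ->]; exact: filter_bigI. Qed.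

Section FinitelyPrecompact.
Context {I X : topologicalType}.
Implicit Types (A B : I -> set X) (L : set I).

(** An arbitrary indexed family lets [A b] be either [b^-1 S] or [S b^-1], so one argument serves
    both sides. *)
Definition finitely_precompact A L : Prop :=
  exists F, [/\ finite_set F, F `<=` L & precompact (\bigcap_(b in F) A b)].

Lemma not_finitely_precompact_ultra A L : ~ finitely_precompact A L ->
  exists W : set_system X, [/\ UltraFilter W, forall b, L b -> W (A b) &
    forall K, precompact K -> ~ W K].
Proof.
move=> nA.
pose D : set (set I * set X) :=
  [set p | [/\ finite_set p.1, p.1 `<=` L & precompact p.2]].
pose Q (p : set I * set X) := (\bigcap_(b in p.1) A b) `\` p.2.
have pQ : ProperFilter (filter_from D Q).
  apply: filter_from_proper.
    apply: filter_from_filter.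
      by exists (set0, set0); split => //; exact: precompact0.
    move=> [F K] [F' K'] [/= fF FL pK] [/= fF' FL' pK'].
    exists (F `|` F', K `|` K').
      split; rewrite /= ?finite_setU //; last exact: precompactU.
      by move=> b [/FL|/FL'].
    rewrite /Q /= bigcap_setU => x [[FAx F'Ax] /not_orP[nK nK']].
    by split; split.
  (* If [Q (F, K)] were empty, the intersection over [F] would lie in [K], against [nA]. *)
  move=> [F K] [/= fF FL pK]; apply/set0P/negP => /eqP Q0.
  by apply: nA; exists F; split => //; apply: precompact_subset pK; rewrite -setD_eq0.
have [W [UW QW]] := ultraFilterLemma pQ.
exists W; split => // [b Lb|K pK WK].
  apply: QW; exists ([set b], set0).
    by split => //=; [move=> _ ->|exact: precompact0].
  by move=> x [/(_ b erefl)].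
have WnK : W (~` K).
  (* The intersection over no index is the whole space, so this base set is the complement of
     [K]. *)
  apply: QW; exists (set0, K); first by split.
  by move=> x [].
apply: (@filter_not_empty _ W _).
by rewrite -(setICr K); exact: filterI.
Qed.

Lemma finitely_precompactU A B :
  (forall L, ~ precompact L -> finitely_precompact A L) ->
  (forall L, ~ precompact L -> finitely_precompact B L) ->
  forall L, ~ precompact L ->
    finitely_precompact (fun b => A b `|` B b) L.
Proof.
move=> hA hB L npL; apply: contrapT => /not_finitely_precompact_ultra.
move=> [W [UW LW nW]].
have small (C : I -> set X) : (forall L, ~ precompact L -> finitely_precompact C L) ->
    precompact (L `&` [set b | W (C b)]).
  move=> hC; apply: contrapT => /hC[F [fF FL]] /nW; apply.
  by apply: filter_bigcap_finite => // b /FL[].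
apply: npL; apply: precompact_subset (precompactU _ _ (small A hA) (small B hB)).
move=> b Lb; have [WA|WnA] := in_ultra_setVsetC (A b) UW; first by left.
(* Both the union of [A b] and [B b] and the complement of [A b] are in [W]; they meet inside
   [B b]. *)
right; split => //=; apply: filterS (filterI (LW b Lb) WnA).
by move=> x [[]].
Qed.

End FinitelyPrecompact.

Lemma translation_compactU {G : topologicalGroupType} (S S' : set G) :
  translation_compact S -> translation_compact S' ->
  translation_compact (S `|` S').
Proof.
move=> [rS lS] [rS' lS']; split=> L npL.
  have [F [fF FL pF]] := finitely_precompactU _ _ rS rS' _ npL.
  (* Translation by [b^-1] distributes over the union of [S] and [S']. *)
  exists F; split=> //; by rewrite (eq_bigcapr (fun b _ => image_setU _ _ _)).
have [F [fF FL pF]] := finitely_precompactU _ _ lS lS' _ npL.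
exists F; split=> //; by rewrite (eq_bigcapr (fun b _ => image_setU _ _ _)).
Qed.

Theorem corollary5p4 (G : topologicalGroupType)
    (G_lc : locally_compact [set: G]) (G_E : E_group G)
    (T1 T2 U : set G) (U_nbhs : nbhs (1 : G) U)
    (T12_ud : right_uniformly_discrete U (T1 `|` T2))
    (UT1_tc : translation_compact (mulset U T1))
    (UT2_tc : translation_compact (mulset U T2)) :
  exists V : set G,
    nbhs (1 : G) V /\ translation_compact (mulset V T1 `|` mulset V T2).
(* The neighbourhood [V] can be [U] itself. *)
Proof. by exists U; split => //; exact: translation_compactU. Qed.
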